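(* A perfect Euler brick exists if and only if there exist coprime positive integers $a > b$ with $a-b$ odd, and a rational number $\lambda \notin \{0, 1, -1\}$, such that, with $U_1 = a^2-b^2$, $V_1 = 2ab$, $W_1 = a^2+b^2$, both $$f_1 = W_1^2(\lambda^2-1)^2 + 4U_1^2\lambda^2 \quad\text{and}\quad f_2 = W_1^2(\lambda^2-1)^2 + 4V_1^2\lambda^2$$ are perfect squares (i.e. squares of rational numbers).
   Context: A perfect Euler brick is a triple of positive integers $(e_1,e_2,e_3)$ such that $e_1^2+e_2^2$, $e_1^2+e_3^2$, $e_2^2+e_3^2$ and $e_1^2+e_2^2+e_3^2$ are all squares of positive integers. *)

(* Defs.v *)
From mathcomp Require Import all_boot all_order all_algebra.

Set Implicit Arguments.
Unset Strict Implicit.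
Unset Printing Implicit Defensive.

Import GRing.Theory.

Definition is_pos_square (n : nat) : Prop :=
  exists2 m : nat, (0 < m)%N & n = (m ^ 2)%N.

Definition perfect_Euler_brick (e1 e2 e3 : nat) : Prop :=
  [/\ (0 < e1)%N, (0 < e2)%N & (0 < e3)%N] /\
  [/\ is_pos_square (e1 ^ 2 + e2 ^ 2)%N,
      is_pos_square (e1 ^ 2 + e3 ^ 2)%N,
      is_pos_square (e2 ^ 2 + e3 ^ 2)%N &
      is_pos_square (e1 ^ 2 + e2 ^ 2 + e3 ^ 2)%N].

Definition is_rat_square (x : rat) : Prop := exists y : rat, x = (y ^+ 2)%R.

(* Main.v *)
Require Import Defs.
From mathcomp Require Import all_boot all_order all_algebra.
From mathcomp Require Import zify ring lra.

Import GRing.Theory Order.TTheory Num.Theory.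
Local Open Scope ring_scope.

(** Two parametrizations of Pythagorean triples are composed.  A brick
    [(e1, e2, e3)] with face diagonal [m] and space diagonal [d] contains the
    triples [(e1, e2, m)] and [(m, e3, d)].  Up to order the first is proportional
    to [(U1, V1, W1)], and the second is proportional to
    [(2 * lambda, lambda ^ 2 - 1, lambda ^ 2 + 1)] with [lambda = (d + e3) / m].
    So the brick is proportional to
    [(2 * U1 * lambda, 2 * V1 * lambda, W1 * (lambda ^ 2 - 1))], whose two other
    face diagonals have squares [f1] and [f2]. *)

(** Being coprime and of equal parity, [p] and [q] are both odd. Take [b] as half their difference
    and [a = b + q]: a common divisor of [a] and [b] divides [p] and [q]. *)
Lemma half_sum_diff_odd (p q : nat) :
  (0 < q < p)%N -> coprime p q -> ~~ odd (p - q) ->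
  exists a b : nat,
    [/\ (0 < b)%N, (b < a)%N, coprime a b & odd (a - b)] /\
    p = (a + b)%N /\ q = (a - b)%N.
Proof.
move=> /andP[q0 qp] cpq par.
have [b Eb] : exists b, (p - q = b.*2)%N.
  by exists (p - q)./2; rewrite even_halfK.
have Ep : p = (b + q + b)%N by lia.
have Eq : q = (b + q - b)%N by lia.
have cab : coprime (b + q) b.
  rewrite /coprime -dvdn1 -(eqP cpq) dvdn_gcd.
  by rewrite [X in (_ %| X)%N]Ep [X in (_ && (_ %| X))%N]Eq dvdn_add ?dvdn_sub
    ?dvdn_gcdl ?dvdn_gcdr.
have oq : odd (b + q - b).
  rewrite -Eq; apply/negPn/negP => eq2.
  have : (2 %| gcdn p q)%N by rewrite dvdn_gcd; lia.
  by rewrite (eqP cpq).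
exists (b + q)%N, b; split=> //; split=> //; lia.
Qed.

(* [y / (m + x) = q / p] is the half-angle tangent.  When [p] and [q] are both odd,
   passing to [(p + q) / 2] and [(p - q) / 2] exchanges the two legs. *)
Lemma pythagorean_triple_param (x y m : nat) :
  (0 < x)%N -> (0 < y)%N -> (x ^ 2 + y ^ 2 = m ^ 2)%N ->
  exists a b : nat,
    [/\ (0 < b)%N, (b < a)%N, coprime a b & odd (a - b)] /\
    let U : rat := a%:R ^+ 2 - b%:R ^+ 2 in
    let V : rat := 2 * a%:R * b%:R in
    let W : rat := a%:R ^+ 2 + b%:R ^+ 2 in
    (x%:R * W = m%:R * U /\ y%:R * W = m%:R * V) \/
    (y%:R * W = m%:R * U /\ x%:R * W = m%:R * V).
Proof.
move=> x0 y0 e.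
have ym : (y < m + x)%N by nia.
pose g := gcdn (m + x) y.
have g0 : (0 < g)%N by rewrite gcdn_gt0 y0 orbT.
pose p := ((m + x) %/ g)%N; pose q := (y %/ g)%N.
have Ep : (m + x = p * g)%N by rewrite divnK ?dvdn_gcdl.
have Eq : (y = q * g)%N by rewrite divnK ?dvdn_gcdr.
have cpq : coprime p q.
  by rewrite /coprime -(eqn_pmul2r g0) muln_gcdl -Ep -Eq mul1n.
have q0 : (0 < q)%N by nia.
have qp : (q < p)%N by nia.
have gR : (g%:R : rat) != 0 by rewrite pnatr_eq0; lia.
have EpR : (m%:R + x%:R : rat) = p%:R * g%:R by rewrite -natrD -natrM Ep.
have EqR : (y%:R : rat) = q%:R * g%:R by rewrite -natrM -Eq.
have eR : (x%:R ^+ 2 + y%:R ^+ 2 : rat) = m%:R ^+ 2.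
  by rewrite -!natrX -natrD e.
have pR : (p%:R : rat) != 0 by rewrite pnatr_eq0; lia.
(* This is [(m - x) * (m + x) = y ^ 2] with one factor [g] cancelled. *)
have Em : (m%:R - x%:R : rat) * p%:R = q%:R ^+ 2 * g%:R.
  by apply: (mulIf gR); rewrite -mulrA -EpR; move: eR; rewrite EqR; lra.
have hx : (x%:R : rat) * (p%:R ^+ 2 + q%:R ^+ 2) = m%:R * (p%:R ^+ 2 - q%:R ^+ 2).
  have : (m%:R - x%:R : rat) * p%:R ^+ 2 = q%:R ^+ 2 * (m%:R + x%:R).
    by rewrite EpR expr2 mulrA Em; ring.
  lra.
have hy : (y%:R : rat) * (p%:R ^+ 2 + q%:R ^+ 2) = m%:R * (2 * p%:R * q%:R).
  have : (y%:R : rat) * p%:R = q%:R * (m%:R + x%:R) by rewrite EqR EpR; ring.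
  move=> E1.
  have : (y%:R : rat) * q%:R = (m%:R - x%:R) * p%:R by rewrite EqR Em; ring.
  move=> E2.
  have -> : (y%:R : rat) * (p%:R ^+ 2 + q%:R ^+ 2)
    = (y%:R * p%:R) * p%:R + (y%:R * q%:R) * q%:R by ring.
  by rewrite E1 E2; ring.
have [par | par] := boolP (odd (p - q)).
  by exists p, q; split=> //; left.
have q0p : (0 < q < p)%N by rewrite q0.
have [a [b [ab [pE qE]]]] := half_sum_diff_odd _ _ q0p cpq par.
(* Here [p ^ 2 + q ^ 2 = 2 * W], [p ^ 2 - q ^ 2 = 2 * V] and [2 * p * q = 2 * U]; the factor 2
   cancels. *)
exists a, b; split=> //=; right.
have ba : (b <= a)%N by case: ab => _ /ltnW.
move: hx hy; rewrite pE qE natrD natrB // => hx hy.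
by split; [move: hy | move: hx]; lra.
Qed.

(** The product of all denominators works; positivity makes the numerators natural numbers. *)
Lemma common_denominator (s : seq rat) :
  all (fun x => 0 < x) s ->
  exists2 D : nat, (0 < D)%N &
    forall x, x \in s -> exists2 n : nat, (0 < n)%N & x * D%:R = n%:R.
Proof.
elim: s => [|x s IHs] /=; first by exists 1%N.
case/andP=> x0 /IHs[D D0 hD].
pose d := `|denq x|%N; pose n := `|numq x|%N.
have d0 : (0 < d)%N by rewrite absz_gt0 denq_neq0.
have n0 : (0 < n)%N by rewrite absz_gt0 numq_eq0 gt_eqF.
have xE : x * d%:R = n%:R.
  rewrite -[x in LHS]divq_num_den !pmulrn /d /n !gez0_abs ?ltW ?numq_gt0 //.
  by rewrite divfK // intr_eq0 denq_neq0.
exists (d * D)%N => [|y]; first by rewrite muln_gt0 d0.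
rewrite inE => /orP[/eqP-> | /hD[k k0 yE]].
  by exists (n * D)%N; rewrite ?muln_gt0 ?n0 // !natrM mulrA xE.
exists (k * d)%N; first by rewrite muln_gt0 k0.
by rewrite !natrM mulrCA yE mulrC.
Qed.

Lemma is_rat_square_gt0 (x : rat) :
  0 < x -> is_rat_square x -> exists2 y : rat, 0 < y & x = y ^+ 2.
Proof.
move=> x0 [y xE]; exists `|y|; last by rewrite real_normK ?num_real.
by rewrite normr_gt0 -sqrf_eq0 -xE gt_eqF.
Qed.

(** The brick conditions are homogeneous, so denominators can be cleared. The four diagonals are
    scaled along with the edges, so that they too become positive integers. *)
Lemma rational_Euler_brick (r1 r2 r3 : rat) :
  0 < r1 -> 0 < r2 -> 0 < r3 ->
  is_rat_square (r1 ^+ 2 + r2 ^+ 2) -> is_rat_square (r1 ^+ 2 + r3 ^+ 2) ->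
  is_rat_square (r2 ^+ 2 + r3 ^+ 2) ->
  is_rat_square (r1 ^+ 2 + r2 ^+ 2 + r3 ^+ 2) ->
  exists e1 e2 e3 : nat, perfect_Euler_brick e1 e2 e3.
Proof.
move=> r1_gt0 r2_gt0 r3_gt0.
move=> /is_rat_square_gt0[|s12 s12_gt0 E12]; first by rewrite addr_gt0 ?exprn_gt0.
move=> /is_rat_square_gt0[|s13 s13_gt0 E13]; first by rewrite addr_gt0 ?exprn_gt0.
move=> /is_rat_square_gt0[|s23 s23_gt0 E23]; first by rewrite addr_gt0 ?exprn_gt0.
move=> /is_rat_square_gt0[|s s_gt0 E]; first by rewrite !addr_gt0 ?exprn_gt0.
have [|D D0 hD] := common_denominator [:: r1; r2; r3; s12; s13; s23; s].
  by rewrite /= r1_gt0 r2_gt0 r3_gt0 s12_gt0 s13_gt0 s23_gt0 s_gt0.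
have [|e1 e1_gt0 e1E] := hD r1; rewrite ?inE ?eqxx ?orbT //.
have [|e2 e2_gt0 e2E] := hD r2; rewrite ?inE ?eqxx ?orbT //.
have [|e3 e3_gt0 e3E] := hD r3; rewrite ?inE ?eqxx ?orbT //.
have [|n12 n12_gt0 n12E] := hD s12; rewrite ?inE ?eqxx ?orbT //.
have [|n13 n13_gt0 n13E] := hD s13; rewrite ?inE ?eqxx ?orbT //.
have [|n23 n23_gt0 n23E] := hD s23; rewrite ?inE ?eqxx ?orbT //.
have [|n n_gt0 nE] := hD s; rewrite ?inE ?eqxx ?orbT //.
exists e1, e2, e3; split=> //.
by split; [exists n12 | exists n13 | exists n23 | exists n] => //;
  apply/eqP; rewrite -(eqr_nat rat) !natrD !natrX -?e1E -?e2E -?e3E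
    -?n12E -?n13E -?n23E -?nE !exprMn -!mulrDl ?E ?E12 ?E13 ?E23.
Qed.

(** Substituting [l ^ 2 - 1 = 2 * z * l / m] and [U = x * W / m] turns the expression into
    [(2 * W * l / m) ^ 2 * (x ^ 2 + z ^ 2)]. It serves for both [f1] and [f2], with [U1] or [V1] as
    [U]. *)
Lemma brick_face_square (U W l x m z n : rat) :
  W != 0 -> m != 0 -> z != 0 ->
  x * W = m * U -> 2 * z * l = m * (l ^+ 2 - 1) -> x ^+ 2 + z ^+ 2 = n ^+ 2 ->
  is_rat_square (W ^+ 2 * (l ^+ 2 - 1) ^+ 2 + 4 * U ^+ 2 * l ^+ 2).
Proof.
move=> W0 m0 z0 xE lE nE; exists (2 * W * l * n / m).
have -> : l ^+ 2 - 1 = 2 * z * l / m by rewrite lE mulrC mulKf.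
have -> : U = x * W / m by rewrite xE mulrC mulKf.
have -> : (2 * W * l * n / m) ^+ 2 = (2 * W * l / m) ^+ 2 * n ^+ 2 by field.
by rewrite -nE; field.
Qed.

Theorem proposition2p2 :
  (exists e1 e2 e3 : nat, perfect_Euler_brick e1 e2 e3) <->
  (exists (a b : nat) (lambda : rat),
    [/\ (0 < b)%N, (b < a)%N, coprime a b & odd (a - b)] /\
    [/\ lambda <> 0, lambda <> 1 & lambda <> -1] /\
    let U1 : rat := a%:R ^+ 2 - b%:R ^+ 2 in
    let V1 : rat := 2 * a%:R * b%:R in
    let W1 : rat := a%:R ^+ 2 + b%:R ^+ 2 in
    let f1 := W1 ^+ 2 * (lambda ^+ 2 - 1) ^+ 2 + 4 * U1 ^+ 2 * lambda ^+ 2 in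
    let f2 := W1 ^+ 2 * (lambda ^+ 2 - 1) ^+ 2 + 4 * V1 ^+ 2 * lambda ^+ 2 in
    is_rat_square f1 /\ is_rat_square f2).
Proof.
split.
  case=> e1 [e2 [e3 [[e1_gt0 e2_gt0 e3_gt0]]]].
  case=> -[m m_gt0 mE] [n1 _ n1E] [n2 _ n2E] [d d_gt0 dE].
  have [a [b [ab tripleE]]] := pythagorean_triple_param _ _ _ e1_gt0 e2_gt0 mE.
  have md : (m <= d)%N by rewrite -leq_sqr -dE mE leq_addr.
  have m0 : (m%:R : rat) != 0 by rewrite pnatr_eq0 -lt0n.
  have e30 : (e3%:R : rat) != 0 by rewrite pnatr_eq0 -lt0n.
  have W0 : (a%:R ^+ 2 + b%:R ^+ 2 : rat) != 0.
    by case: ab => b0 _ _ _; rewrite -!natrX -natrD pnatr_eq0; nia.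
  have dER : (m%:R ^+ 2 + e3%:R ^+ 2 : rat) = d%:R ^+ 2.
    by rewrite -!natrX -natrD -mE dE.
  have n1ER : (e1%:R ^+ 2 + e3%:R ^+ 2 : rat) = n1%:R ^+ 2.
    by rewrite -!natrX -natrD n1E.
  have n2ER : (e2%:R ^+ 2 + e3%:R ^+ 2 : rat) = n2%:R ^+ 2.
    by rewrite -!natrX -natrD n2E.
  pose l : rat := (d%:R + e3%:R) / m%:R.
  (* This excludes the values 0, 1 and -1 at once. *)
  have l_gt1 : 1 < l.
    by rewrite ltr_pdivlMr ?ltr0n // mul1r -natrD ltr_nat; lia.
  have lE : 2 * e3%:R * l = m%:R * (l ^+ 2 - 1).
    have -> : m%:R * (l ^+ 2 - 1) = ((d%:R + e3%:R) ^+ 2 - m%:R ^+ 2) / m%:R.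
      by rewrite /l; field.
    have -> : (m%:R ^+ 2 : rat) = d%:R ^+ 2 - e3%:R ^+ 2 by rewrite -dER addrK.
    by rewrite /l; field.
  exists a, b, l; split=> //; split; first by split=> l_val; move: l_gt1; rewrite l_val.
  (* Either of [e1], [e2] may be the leg proportional to [U1]; swapping them swaps [n1] and [n2]. *)
  case: tripleE => -[xE yE]; split.
  - exact: brick_face_square W0 m0 e30 xE lE n1ER.
  - exact: brick_face_square W0 m0 e30 yE lE n2ER.
  - exact: brick_face_square W0 m0 e30 xE lE n2ER.
  - exact: brick_face_square W0 m0 e30 yE lE n1ER.
case=> a [b [l [[b0 ba _ _] [[/eqP l0 /eqP l1 /eqP lN1] /=]]]].
set U := a%:R ^+ 2 - b%:R ^+ 2; set V := 2 * a%:R * b%:R.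
set W := a%:R ^+ 2 + b%:R ^+ 2; move=> [f1 f2].
have b_gt0 : 0 < b%:R :> rat by rewrite ltr0n.
have a_gt0 : 0 < a%:R :> rat by rewrite ltr0n (ltn_trans b0).
have U_gt0 : 0 < U by rewrite subr_gt0 ltr_pXn2r ?nnegrE ?ltW ?ltr_nat.
have V_gt0 : 0 < V by rewrite !mulr_gt0.
have W_gt0 : 0 < W by rewrite addr_gt0 ?exprn_gt0.
have l_gt0 : 0 < `|l| by rewrite normr_gt0.
have l21 : 0 < `|l ^+ 2 - 1|.
  by rewrite normr_gt0 subr_eq0 sqrf_eq1 negb_or l1.
have lK : `|l| ^+ 2 = l ^+ 2 by rewrite real_normK ?num_real.
have l21K : `|l ^+ 2 - 1| ^+ 2 = (l ^+ 2 - 1) ^+ 2 by rewrite real_normK ?num_real.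
apply: (rational_Euler_brick (2 * U * `|l|) (2 * V * `|l|) (W * `|l ^+ 2 - 1|));
  rewrite ?mulr_gt0 // !exprMn lK ?l21K.
(* The outer two roots come from [U ^ 2 + V ^ 2 = W ^ 2] and [(l ^ 2 - 1) ^ 2 + 4 * l ^ 2 = (l ^ 2 +
   1) ^ 2], the middle two from [f1] and [f2]. *)
- by exists (2 * W * l); rewrite /U /V /W; ring.
- by rewrite addrC; case: f1 => y yE; exists y; rewrite -yE; ring.
- by rewrite addrC; case: f2 => y yE; exists y; rewrite -yE /V; ring.
- by exists (W * (l ^+ 2 + 1)); rewrite /U /V /W; ring.
Qed.
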